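(* Let $(X,r)$ be a finite non-degenerate braided set. Let $K$ be a field and let $A=A(K,X,r)$ be its structure algebra, with homogeneous component $A_2$ of degree $2$. Then $\dim_K (A_2)\geq \frac{|X|}{2}$.
   Context: A quadratic set $(X,r)$ is a nonempty set $X$ with a bijective map $r\colon X\times X\to X\times X$, written $r(x,y)=(\sigma_x(y),\gamma_y(x))$. It is non-degenerate if all $\sigma_x$ and $\gamma_x$ are bijective. It is a braided set if $r_1r_2r_1=r_2r_1r_2$ on $X^3$, where $r_1=r\times \mathrm{id}_X$ and $r_2=\mathrm{id}_X\times r$. The structure algebra is the $K$-algebra $A(K,X,r)=K\langle X\mid xy=uv \text{ whenever } r(x,y)=(u,v)\rangle$; it is graded by word length, $A=\bigoplus_{m\ge 0}A_m$, where $A_m$ is the $K$-span of all products $x_1\cdots x_m$ with $x_i\in X$. *)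

(* Defs.v *)
From HB Require Import structures.
From mathcomp Require Import all_boot all_order all_algebra.
From mathcomp Require Import boolp monalg.

Set Implicit Arguments.
Unset Strict Implicit.
Unset Printing Implicit Defensive.

Import GRing.Theory Num.Theory.
Local Open Scope ring_scope.
Local Open Scope quotient_scope.

Section BraidedSets.
Variables (X : Type) (r : X * X -> X * X).

Definition sigma (x y : X) : X := (r (x, y)).1.
Definition gamma (y x : X) : X := (r (x, y)).2.

Definition quadratic_set : Prop := inhabited X /\ bijective r.

Definition non_degenerate : Prop :=
  (forall x, bijective (sigma x)) /\ (forall y, bijective (gamma y)).

Definition r1 (t : X * X * X) : X * X * X :=
  let: (x, y, z) := t in (r (x, y), z).

Definition r2 (t : X * X * X) : X * X * X :=
  let: (x, y, z) := t in let: (u, v) := r (y, z) in (x, u, v).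

Definition braided_set : Prop :=
  quadratic_set /\ forall t, r1 (r2 (r1 t)) = r2 (r1 (r2 t)).
End BraidedSets.

Section StructureAlgebra.
Variables (K : fieldType) (X : choiceType) (r : X * X -> X * X).

(* The monoid algebra over K of the free monoid on X, i.e. K<X>. *)
Notation freeAlg := {malg K[{fmonom X}]}.

Definition fgen (x : X) : freeAlg := << fmu x >>.

Definition rel_elt (p : X * X) : freeAlg :=
  fgen p.1 * fgen p.2 - fgen (r p).1 * fgen (r p).2.

(* [freeAlg] is unital, so the finite sums of terms a * rel_elt p * b form the
   two-sided ideal generated by the [rel_elt p]; no K-coefficients are needed. *)
Definition rel_ideal (f : freeAlg) : bool :=
  `[< exists s : seq (freeAlg * (X * X) * freeAlg),
        f = \sum_(t <- s) t.1.1 * rel_elt t.1.2 * t.2 >].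

Lemma rel_idealP f :
  reflect (exists s : seq (freeAlg * (X * X) * freeAlg),
             f = \sum_(t <- s) t.1.1 * rel_elt t.1.2 * t.2)
          (f \in rel_ideal).
Proof. exact: asboolP. Qed.

Lemma rel_idealMl a f : f \in rel_ideal -> a * f \in rel_ideal.
Proof.
move=> /rel_idealP[s ->]; apply/rel_idealP.
exists [seq (a * t.1.1, t.1.2, t.2) | t <- s].
by rewrite big_map mulr_sumr; apply: eq_bigr => t _; rewrite !mulrA.
Qed.

Lemma rel_idealMr a f : f \in rel_ideal -> f * a \in rel_ideal.
Proof.
move=> /rel_idealP[s ->]; apply/rel_idealP.
exists [seq (t.1.1, t.1.2, t.2 * a) | t <- s].
rewrite big_map mulr_suml; apply: eq_bigr => t _.
exact: (esym (mulrA (t.1.1 * rel_elt t.1.2) t.2 a)).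
Qed.

Lemma rel_ideal_zmod_closed : zmod_closed rel_ideal.
Proof.
split=> [|f g]; first by apply/rel_idealP; exists [::]; rewrite big_nil.
move=> /rel_idealP[s ->] /(rel_idealMl (-1)) /rel_idealP[s' eq_s'].
apply/rel_idealP; exists (s ++ s').
by rewrite big_cat -eq_s' mulN1r.
Qed.

HB.instance Definition _ :=
  GRing.isZmodClosed.Build freeAlg rel_ideal rel_ideal_zmod_closed.

Lemma rel_ideal1 : 1 \notin rel_ideal.
Proof.
have gen0 x : mcoeff mone (fgen x) = 0 by rewrite mcoeffU1 fm1_eq1.
have mcoeff1M : {morph mcoeff mone : f g / f * g : freeAlg >-> f * g}.
  exact: (rmorphM (mcoeff mone : {rmorphism freeAlg -> K})).
have rel0 p : mcoeff mone (rel_elt p) = 0.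
  have gen2 x y : mcoeff mone (fgen x * fgen y) = 0.
    by apply: etrans (mcoeff1M _ _) _; rewrite (gen0 x) mul0r.
  apply: etrans (mcoeffB _ _ _) _.
  by apply: etrans (congr2 (fun a b => a - b) (gen2 _ _) (gen2 _ _)) (subrr 0).
apply/rel_idealP => -[s /(congr1 (mcoeff mone))] /eqP.
rewrite mcoeff1 eqxx raddf_sum big1 ?oner_eq0 // => t _ /=.
rewrite (mcoeff1M (t.1.1 * rel_elt t.1.2) t.2).
by rewrite (mcoeff1M t.1.1 (rel_elt t.1.2)) rel0 mulr0 mul0r.
Qed.

Definition rel_idealZ : zmodClosed freeAlg :=
  GRing.ZmodClosed.clone freeAlg rel_ideal _.

Definition structAlg : Type := Quotient.quot rel_idealZ.
HB.instance Definition _ := EqQuotient.on structAlg.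
HB.instance Definition _ := GRing.Zmodule.on structAlg.

Definition struct_pr (f : freeAlg) : structAlg := \pi f.

Lemma struct_prP f g : struct_pr f = struct_pr g <-> f - g \in rel_ideal.
Proof.
rewrite -[f - g \in _]/(f - g \in rel_idealZ) Quotient.idealrBE.
by split=> /eqP.
Qed.

Lemma struct_prK a : struct_pr (repr a) = a.
Proof. exact: reprK. Qed.

Lemma struct_pr_repr f : repr (struct_pr f) - f \in rel_ideal.
Proof. by apply/struct_prP; rewrite struct_prK. Qed.

Fact struct_prB : {morph struct_pr : f g / f - g}.
Proof. by move=> f g; rewrite /struct_pr raddfB. Qed.

Fact struct_prD : {morph struct_pr : f g / f + g}.
Proof. by move=> f g; rewrite /struct_pr raddfD. Qed.

Definition struct_one : structAlg := struct_pr 1.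
Definition struct_mul (a b : structAlg) : structAlg :=
  struct_pr (repr a * repr b).
Definition struct_scale (c : K) (a : structAlg) : structAlg :=
  struct_pr (c *: repr a).

Fact struct_prM f g : struct_pr (f * g) = struct_mul (struct_pr f) (struct_pr g).
Proof.
apply/esym/struct_prP; set f' := repr _; set g' := repr _.
have -> : f' * g' - f * g = (f' - f) * g' + f * (g' - g).
  by rewrite mulrBl mulrBr addrA subrK.
apply: (rpredD (S := rel_idealZ)).
  exact/rel_idealMr/struct_pr_repr.
exact/rel_idealMl/struct_pr_repr.
Qed.

Fact struct_prZ c f : struct_pr (c *: f) = struct_scale c (struct_pr f).
Proof.
apply/esym/struct_prP; rewrite -scalerBr -mul_malgC.
exact/rel_idealMl/struct_pr_repr.
Qed.

Let prK := struct_prK.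

Fact struct_mulA : associative struct_mul.
Proof.
by move=> a b c; rewrite -(prK a) -(prK b) -(prK c) -!struct_prM mulrA.
Qed.

Fact struct_mul1 : left_id struct_one struct_mul.
Proof. by move=> a; rewrite -(prK a) -struct_prM mul1r. Qed.

Fact struct_mulr1 : right_id struct_one struct_mul.
Proof. by move=> a; rewrite -(prK a) -struct_prM mulr1. Qed.

Fact struct_mulDl : left_distributive struct_mul +%R.
Proof.
move=> a b c; rewrite -(prK a) -(prK b) -(prK c).
move: (repr a) (repr b) (repr c) => f g h.
by rewrite -(struct_prD f g) -!struct_prM -struct_prD mulrDl.
Qed.

Fact struct_mulDr : right_distributive struct_mul +%R.
Proof.
move=> a b c; rewrite -(prK a) -(prK b) -(prK c).
move: (repr a) (repr b) (repr c) => f g h.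
by rewrite -(struct_prD g h) -!struct_prM -struct_prD mulrDr.
Qed.

Fact struct_pr0 : struct_pr 0 = 0.
Proof. by rewrite -(subrr 0) struct_prB subrr. Qed.

Fact struct_one_neq0 : struct_one != 0.
Proof.
apply/eqP; rewrite -struct_pr0 => /struct_prP.
by rewrite subr0; apply/negP/rel_ideal1.
Qed.

HB.instance Definition _ := GRing.Zmodule_isNzRing.Build structAlg
  struct_mulA struct_mul1 struct_mulr1 struct_mulDl struct_mulDr struct_one_neq0.

Fact struct_scaleA c d a :
  struct_scale c (struct_scale d a) = struct_scale (c * d) a.
Proof. by rewrite -(prK a) -!struct_prZ scalerA. Qed.

Fact struct_scale1 : left_id 1 struct_scale.
Proof. by move=> a; rewrite -(prK a) -struct_prZ scale1r. Qed.

Fact struct_scaleDr : right_distributive struct_scale +%R.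
Proof.
move=> c a b; rewrite -(prK a) -(prK b) -struct_prD -!struct_prZ.
by rewrite -struct_prD scalerDr.
Qed.

Fact struct_scaleDl a : {morph struct_scale^~ a : c d / c + d}.
Proof.
by move=> c d; rewrite -(prK a) -!struct_prZ -struct_prD scalerDl.
Qed.

HB.instance Definition _ := GRing.Zmodule_isLmodule.Build K structAlg
  struct_scaleA struct_scale1 struct_scaleDr struct_scaleDl.

Fact struct_scaleAl c (a b : structAlg) : c *: (a * b) = (c *: a) * b.
Proof.
change (struct_scale c (struct_mul a b) = struct_mul (struct_scale c a) b).
by rewrite -(prK a) -(prK b) -struct_prM -!struct_prZ -struct_prM scalerAl.
Qed.

HB.instance Definition _ :=
  GRing.Lmodule_isLalgebra.Build K structAlg struct_scaleAl.

Fact freeAlg_scaleAr c (f g : freeAlg) : c *: (f * g) = f * (c *: g).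
Proof.
suff malgC_comm : c%:MP * f = f * c%:MP.
  rewrite -(mul_malgC c (f * g)) -(mul_malgC c g).
  by apply: etrans (mulrA _ _ _) _; rewrite malgC_comm; apply/esym/mulrA.
rewrite !malgM_def fgmulUg fgmulgU; apply: eq_bigr => k _.
by rewrite mul1m mulm1 mulrC.
Qed.

Fact struct_scaleAr c (a b : structAlg) : c *: (a * b) = a * (c *: b).
Proof.
change (struct_scale c (struct_mul a b) = struct_mul a (struct_scale c b)).
rewrite -(prK a) -(prK b) -struct_prM -!struct_prZ -struct_prM.
by rewrite freeAlg_scaleAr.
Qed.

HB.instance Definition _ :=
  GRing.Lalgebra_isAlgebra.Build K structAlg struct_scaleAr.

Fact struct_pr_is_linear : linear struct_pr.
Proof. by move=> c f g; rewrite struct_prD struct_prZ. Qed.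

HB.instance Definition _ :=
  GRing.isLinear.Build K freeAlg structAlg *:%R struct_pr struct_pr_is_linear.

Fact struct_pr_is_monoid_morphism : monoid_morphism struct_pr.
Proof. by split=> [|f g]; [reflexivity | exact: struct_prM]. Qed.

HB.instance Definition _ :=
  GRing.isMonoidMorphism.Build freeAlg structAlg struct_pr
    struct_pr_is_monoid_morphism.

Definition struct_gen (x : X) : structAlg := struct_pr (fgen x).

Lemma struct_gen_rel x y u v : r (x, y) = (u, v) ->
  struct_gen x * struct_gen y = struct_gen u * struct_gen v.
Proof.
move=> rxy; rewrite -!rmorphM; apply/struct_prP/rel_idealP.
exists [:: (1, (x, y), 1)].
by rewrite big_seq1 /= mul1r mulr1 /rel_elt /= rxy.
Qed.

Definition homcomp (m : nat) (a : structAlg) : Prop :=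
  exists s : seq (K * m.-tuple X),
    a = \sum_(t <- s) t.1 *: \prod_(x <- t.2) struct_gen x.
End StructureAlgebra.

Arguments struct_gen K {X} r x.
Arguments homcomp K {X} r m a.

Section Dimension.
Variables (K : fieldType) (V : lmodType K).

Definition is_basis (W : V -> Prop) (n : nat) (v : 'I_n -> V) : Prop :=
  [/\ forall i, W (v i),
      forall c : 'I_n -> K, \sum_i c i *: v i = 0 -> forall i, c i = 0
    & forall w, W w -> exists c : 'I_n -> K, w = \sum_i c i *: v i].

Definition has_dim (W : V -> Prop) (n : nat) : Prop :=
  exists v : 'I_n -> V, is_basis W v.

(* [subspace_dim W] is [0] when [W] has no finite basis. *)
Definition subspace_dim (W : V -> Prop) : nat :=
  if pselect (exists n, has_dim W n) is left ex then projT1 (cid ex) else 0%N.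

Lemma has_dim_leq (W : V -> Prop) m n : has_dim W m -> has_dim W n -> (m <= n)%N.
Proof.
move=> [u [Wu free_u _]] [v [_ _ gen_v]].
have /choice[C uE] : forall i, exists c : 'I_n -> K, u i = \sum_j c j *: v j.
  by move=> i; apply: gen_v.
pose M := \matrix_(i, j) C i j.
suff /eqP <- : row_free M by exact: rank_leq_col.
rewrite -kermx_eq0; apply/rowV0P => c /sub_kermxP cM0.
apply/rowP => i; rewrite mxE; apply: (free_u (c 0)).
under eq_bigr do rewrite uE scaler_sumr.
rewrite exchange_big big1 // => j _.
under eq_bigr do rewrite scalerA.
rewrite -scaler_suml; move/rowP/(_ j): cM0; rewrite !mxE.
by under eq_bigr do rewrite mxE; move=> ->; rewrite scale0r.
Qed.

Lemma subspace_dimE (W : V -> Prop) n : has_dim W n -> subspace_dim W = n.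
Proof.
move=> dimWn; rewrite /subspace_dim; case: pselect => [ex|[]]; last by exists n.
case: cid => m dimWm /=; apply/eqP.
by rewrite eqn_leq !(has_dim_leq (W := W)).
Qed.
End Dimension.

(* Main.v *)
From HB Require Import structures.
Require Import Defs.
From mathcomp Require Import all_boot all_order all_algebra.
From mathcomp Require Import monalg.
Import GRing.Theory Num.Theory.
Local Open Scope ring_scope.
Set Implicit Arguments.
Unset Strict Implicit.
Unset Printing Implicit Defensive.

(** The relations of degree two identify the word [x y] with the word [u v]
    when [r (x, y) = (u, v)], so the words of length two taken up to the orbits
    of the permutation [r] of [X * X] form a basis of [A_2], and [dim A_2] is
    the number of these orbits ([has_dim_degree2]). It remains to see that
    there are at least [|X| / 2] orbits ([leq_card_froots]).

    The guitar map [(x, y) |-> (x, sigma_x y)] is a bijection that conjugates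
    [r] to the derived solution [(x, u) |-> (u, tau_u x)] ([guitarP]), and the
    braid equation for [r] makes [tau] a rack: each [tau_u] is injective and
    self-distributive ([tau_tau]). In a rack, [q x := tau_x x] is a permutation
    and [tau_(q x) = tau_x] ([tau_square], [square_inj]). Hence [tau_y] acts as
    [q] on the whole [q]-cycle of [y], so for a [q]-cycle [C] of length [a] the
    derived solution preserves [C * C] and acts there by
    [(q^i b, q^j b) |-> (q^j b, q^(i+1) b)]. Its square shifts both indices by
    one, so these orbits have at most [2 a] elements, and the [a^2] pairs of
    [C * C] fill at least [a / 2] orbits. Summing over the cycles gives the
    bound.

    Instead of dividing [a^2] by [2 a], the proof fixes a base point [b] in
    each cycle and sends [y], in the cycle of [b], to the orbit of [(b, y)].
    Such an orbit contains at most two pairs with first entry [b]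
    ([iter_derived_base]), so this map from [X] to the orbits has fibers of at
    most two elements. *)

(** * Counting by fibers *)

Lemma leq_card_fibers (X T : finType) (A : {pred T}) (f : X -> T) k :
    (forall x, f x \in A) ->
    (forall x, (#|[set y | f y == f x]| <= k)%N) ->
  (#|X| <= k * #|A|)%N.
Proof.
move=> fA fib; rewrite -[#|X|]sum1_card (partition_big f (mem A)) //=.
rewrite mulnC -sum_nat_const; apply: leq_sum => t _.
rewrite sum1_card; have [x fx_t | none] := pickP [pred x | f x == t].
  apply: leq_trans (fib x); apply: subset_leq_card.
  by apply/subsetP => y; rewrite !inE (eqP fx_t).
by rewrite (eq_card0 (A := [pred x | f x == t])) //; apply: none.
Qed.

(** * The derived rack and the orbits of a braided set *)

Section DerivedRack.
Variables (X : finType) (r : X * X -> X * X).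
Hypotheses (r_braided : braided_set r) (r_nondeg : non_degenerate r).

Local Notation "x ▷ y" := (sigma r x y) (at level 40, left associativity).
Local Notation "x ◁ y" := (gamma r y x) (at level 40, left associativity).

Lemma braid_eqs x y z :
  [/\ x ▷ y ▷ ((x ◁ y) ▷ z) = x ▷ (y ▷ z),
      (x ▷ y) ◁ ((x ◁ y) ▷ z) = (x ◁ (y ▷ z)) ▷ (y ◁ z)
    & (x ◁ y) ◁ z = (x ◁ (y ▷ z)) ◁ (y ◁ z)].
Proof.
have [_ /(_ (x, y, z))] := r_braided; rewrite /r1 /r2 /sigma /gamma.
by do ![case: (r _) => ? ? /=] => -[-> -> ->].
Qed.

Lemma sigma_inj x : injective (sigma r x).
Proof. by case: r_nondeg => sb _; apply: bij_inj (sb x). Qed.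

Definition sigma_inv x : X -> X := invF (@sigma_inj x).

Lemma sigma_invK x : cancel (sigma r x) (sigma_inv x).
Proof. exact: invF_f. Qed.
Lemma sigmaKV x : cancel (sigma_inv x) (sigma r x).
Proof. exact: f_invF. Qed.

(** Chosen so that [derived], the map that sends [(x, u)] to [(u, tau u x)], is
    the conjugate of [r] by the guitar map. *)
Definition tau u x := u ▷ (x ◁ sigma_inv x u).
Definition derived (p : X * X) := (p.2, tau p.2 p.1).
Definition guitar (p : X * X) := (p.1, p.1 ▷ p.2).

(** The form in which [tau] is computed: every argument of [tau _ x] is some
    [x ▷ y], by surjectivity of [sigma r x]. *)
Lemma tau_sigma x y : tau (x ▷ y) x = x ▷ y ▷ (x ◁ y).
Proof. by rewrite /tau sigma_invK. Qed.

Lemma guitarP p : guitar (r p) = derived (guitar p).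
Proof.
case: p => x y; rewrite /guitar /derived /= tau_sigma /sigma /gamma.
by case: (r (x, y)).
Qed.

Lemma guitar_inj : injective guitar.
Proof. by move=> [x y] [x' y'] [<-] /sigma_inj ->. Qed.

(** Each [sigma r a] is an automorphism of the derived rack: for
    [u = x ▷ y], this is what the first two components of the braid equation on
    [(a, x, y)] and the first one on [(a, x ▷ y, x ◁ y)] say in terms of
    [tau]. *)
Lemma sigma_tau a u x : a ▷ tau u x = tau (a ▷ u) (a ▷ x).
Proof.
rewrite -[u](sigmaKV x); set y := sigma_inv x u.
have [+ + _] := braid_eqs a x y; have [e _ _] := braid_eqs a (x ▷ y) (x ◁ y).
by move=> e1 e2; rewrite -[in RHS]e1 !tau_sigma -e e2 e1.
Qed.

(** Finiteness enters here: the guitar map is injective, hence onto, so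
    [derived] inherits the injectivity of [r], and then so does each
    [tau u]. *)
Lemma derived_inj : injective derived.
Proof.
have r_inj : injective r by case: r_braided => -[_ /bij_inj].
move=> p q; rewrite -(f_invF guitar_inj p) -(f_invF guitar_inj q) -!guitarP.
by move=> /guitar_inj/r_inj ->.
Qed.

Lemma tau_inj u : injective (tau u).
Proof.
by move=> x y e; have /derived_inj[] : derived (x, u) = derived (y, u)
  by congr pair.
Qed.

(** Self-distributivity is the braid equation for [derived]. The braid equation
    for [r] transports to it along the triple guitar map
    [(x, y, z) |-> (x, x ▷ y, x ▷ (y ▷ z))], because the maps [sigma r a] are
    automorphisms. Only the last components carry information. *)
Lemma tau_tau x u v : tau v (tau u x) = tau (tau v u) (tau v x).
Proof.
pose y := sigma_inv x u; pose z := sigma_inv y (sigma_inv x v).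
have uE : u = x ▷ y by rewrite sigmaKV.
have vE : v = x ▷ (y ▷ z) by rewrite !sigmaKV.
have [e1 e2 e3] := braid_eqs x y z.
have [e1' _ _] := braid_eqs x (y ▷ z) (y ◁ z).
have [e4 _ _] := braid_eqs (x ▷ y) ((x ◁ y) ▷ z) ((x ◁ y) ◁ z).
have -> : tau v u = v ▷ ((x ◁ (y ▷ z)) ▷ (y ◁ z)).
  by rewrite vE uE -sigma_tau tau_sigma -e1'.
have -> : tau v x = v ▷ (x ◁ (y ▷ z)) by rewrite vE tau_sigma.
have -> : tau u x = u ▷ (x ◁ y) by rewrite uE tau_sigma.
(* Both sides take the form [v ▷ _]: [e1] and [e4] bring the left side there by
   composing maps [sigma r], and [e2] and [e3] identify the arguments. *)
rewrite -sigma_tau tau_sigma -e2 -e3.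
have -> : v = u ▷ ((x ◁ y) ▷ z) by rewrite vE -e1 uE.
by rewrite -sigma_tau tau_sigma uE e4.
Qed.

Definition square x := tau x x.

(** Self-distributivity with both acting elements equal to [x] reads
    [tau x \o tau x = tau (square x) \o tau x], and [tau x] is onto. *)
Lemma tau_square x : tau (square x) =1 tau x.
Proof.
move=> y; rewrite -(f_invF (@tau_inj x) y).
by rewrite [RHS]tau_tau.
Qed.

Lemma square_inj : injective square.
Proof.
move=> x y e; apply: (@tau_inj x); rewrite -[LHS]/(square x) e.
by rewrite -(tau_square x y) e tau_square.
Qed.

Lemma tau_iter_square i j x :
  tau (iter j square x) (iter i square x) = iter i.+1 square x.
Proof.
have tauE k : tau (iter k square x) =1 tau x.
  by elim: k => //= k IHk y; rewrite tau_square IHk.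
by rewrite tauE -(tauE i).
Qed.

(** On pairs from a single cycle of [square] the derived solution is
    [(i, j) |-> (j, i + 1)] on exponents, whose square is the diagonal shift. *)
Lemma iter_derived_double n i j x :
  iter n.*2 derived (iter i square x, iter j square x) =
  (iter (n + i) square x, iter (n + j) square x).
Proof.
elim: n => // n IHn; rewrite doubleS 2!iterS IHn /derived /=.
by rewrite !tau_iter_square.
Qed.

Lemma iter_derived_orbit n i j x :
  exists k, (iter n derived (iter i square x, iter j square x)).1 =
            iter k square x.
Proof.
elim: n i j => [|n IHn] i j; first by exists i.
by rewrite iterSr /derived /= tau_iter_square; apply: IHn j i.+1.
Qed.

(** The exponents reached from [(0, j)] are [(k, k + j)] after [2 k] steps and
    [(k + j, k + 1)] after [2 k + 1] steps. When the first one vanishes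
    modulo the length of the cycle, the second one is [j] or [1 - j]. *)
Lemma iter_derived_base n j m b :
    iter n derived (b, iter j square b) = (b, iter m square b) ->
  iter m square b = iter j square b \/ iter (j + m) square b = square b.
Proof.
rewrite -[n]odd_double_half addnC iterD.
have dbl := iter_derived_double n./2; move: n./2 dbl => k dbl.
case: (odd n) => /= [|e].
  rewrite /derived /= (tau_iter_square 0 j) (dbl j 1%N b) => -[e1 e2]; right.
  by rewrite iterD -e2 -iterD addnA [(j + k)%N]addnC addn1 iterS e1.
have := dbl 0%N j b; rewrite addn0 [iter 0 _ _]/= e => -[e1 e2].
by left; rewrite e2 addnC iterD -e1.
Qed.

Lemma fconnect_guitar p p' :
  fconnect r p p' -> exists n, iter n derived (guitar p) = guitar p'.
Proof.
move=> /iter_findex <-; exists (findex r p p').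
by elim: (findex r p p') => //= n ->; rewrite guitarP.
Qed.

(** [froots r] has one element in each orbit of [r]. The map [F] below sends [y]
    to the orbit of [(b, y)], for [b] the base point of the cycle of [y]. *)
Lemma leq_card_froots : (#|X| <= 2 * #|froots r|)%N.
Proof.
have r_inj : injective r by case: r_braided => -[_ /bij_inj].
have sq_sym := fconnect_sym square_inj.
pose base := froot square.
pose F y := froot r (invF guitar_inj (base y, y)).
apply: (@leq_card_fibers X (X * X)%type _ F) => [y | y].
  exact/roots_root/fconnect_sym.
have base_iter z : iter (findex square (base z) z) square (base z) = z.
  by apply: iter_findex; rewrite sq_sym connect_root.
pose b := base y; pose j := findex square b y.
have yE : iter j square b = y by apply: base_iter.
(* With [y] the [j]-th iterate of [b], the second candidate is the iterate of
   exponent [1 - j] from [iter_derived_base]. *)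
suff sub : [set z | F z == F y] \subset
           [set y; iter j (finv square) (square b)].
  by apply: leq_trans (subset_leq_card sub) _; rewrite cards2; case: eqP.
apply/subsetP => z; rewrite !inE eq_sym root_connect; last exact: fconnect_sym.
move=> /fconnect_guitar[n]; rewrite !f_invF -/b => e.
(* The first entry stays in one cycle, which forces the base points to agree. *)
have base_z : base z = b.
  have [k] := iter_derived_orbit n 0 j b.
  rewrite [iter 0 _ _]/= yE e /= => zb.
  have /(fingraph.rootP sq_sym) : fconnect square b (base z).
    by rewrite zb fconnect_iter.
  by rewrite /b /base !root_root.
have zE := base_iter z; rewrite base_z in e zE.
move: e; rewrite -{1}yE -{1}zE => /iter_derived_base[].
  by rewrite zE yE => ->; rewrite eqxx.
rewrite iterD zE => <-; apply/orP; right; apply/eqP.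
by elim: (j) => // k IHk; rewrite iterSr iterS finv_f //; apply: square_inj.
Qed.
End DerivedRack.

(** * A basis of the degree two component *)

Lemma mulr_sum3 (R : nzRingType) I J (s : seq I) (t : seq J)
    (F : I -> R) (c : R) (G : J -> R) :
  (\sum_(i <- s) F i) * c * (\sum_(j <- t) G j) =
  \sum_(i <- s) \sum_(j <- t) F i * c * G j.
Proof.
by rewrite mulr_suml mulr_suml; apply: eq_bigr => i _; rewrite mulr_sumr.
Qed.

Lemma sum_scale_delta (R : nzRingType) (V : lmodType R) n (v : 'I_n -> V) a i :
  \sum_j (a * (j == i)%:R) *: v j = a *: v i.
Proof.
rewrite (bigD1 i) //= eqxx mulr1 big1 ?addr0 // => j /negPf->.
by rewrite mulr0 scale0r.
Qed.

Lemma prod_tuple2 (R : nzRingType) T (F : T -> R) (t : 2.-tuple T) :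
  \prod_(x <- t) F x = F (tnth t ord0) * F (tnth t ord_max).
Proof.
rewrite big_tuple !big_ord_recl big_ord0 mulr1.
by congr (_ * F (tnth t _)); apply: val_inj.
Qed.

Section DegreeTwo.
Variables (K : fieldType) (X : finType) (r : X * X -> X * X).
Local Notation freeAlg := {malg K[{fmonom X}]}.
Local Notation gen := (struct_gen K r).

Definition word2 (phi : X * X -> K) (w : {fmonom X}) : K :=
  if (w : seq X) is [:: x; y] then phi (x, y) else 0.

(** A weight [phi] on pairs extends to a linear form on the free algebra that
    sees only the words of length two. When [phi] is constant on the orbits of
    [r], this form factors through the structure algebra, and so separates the
    classes of words in different orbits. *)
Definition quad_form (phi : X * X -> K) : freeAlg -> K := mmap idfun (word2 phi).

HB.instance Definition _ phi :=
  GRing.Additive.copy (quad_form phi) (mmap idfun (word2 phi)).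

Lemma quad_formU phi c w : quad_form phi << c *g w >> = c * word2 phi w.
Proof. exact: mmapU. Qed.

Lemma mul_malgUU c d (v w : {fmonom X}) :
  << c *g v >> * << d *g w >> = << c * d *g mmul v w >> :> freeAlg.
Proof. by rewrite malgM_def fgmulUU. Qed.

Lemma quad_form_gen2 phi c p :
  quad_form phi (c *: (fgen K p.1 * fgen K p.2)) = c * phi p.
Proof.
rewrite -mul_malgC /fgen !mul_malgUU quad_formU !mulr1 mul1m.
by rewrite /word2 fmM !fmU; case: p.
Qed.

(** A word [v x y w] has length two only for empty [v] and [w]; the form then
    compares [phi p] with [phi (r p)]. *)
Lemma quad_form_rel phi f :
  (forall p, phi (r p) = phi p) -> f \in rel_ideal r -> quad_form phi f = 0.
Proof.
move=> phi_r /rel_idealP[s ->]; rewrite raddf_sum big1 // => -[[a p] b] _ /=.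
rewrite [a]monalgE [b]monalgE mulr_sum3 raddf_sum big1 // => v _.
rewrite raddf_sum big1 // => w _.
rewrite /rel_elt /fgen mulrBr mulrBl raddfB /= !mul_malgUU !quad_formU.
rewrite -mulrBr; apply/eqP; rewrite mulf_eq0; apply/orP; right.
rewrite subr_eq0 /word2 !fmM !fmU.
have := phi_r p; case: p (r p) => x y [x' y'] /= phiE.
by case: (v : seq X) (w : seq X) => [|? [|? [|? ?]]] [|? ?] //=;
  rewrite ?phiE ?eqxx.
Qed.

Definition orbit_rep (i : 'I_#|froots r|) : X * X :=
  @enum_val _ (froots r) i.

Lemma froot_rep i : froot r (orbit_rep i) = orbit_rep i.
Proof. exact/eqP/(@enum_valP _ (froots r) i). Qed.

Lemma orbit_rep_inj : injective orbit_rep.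
Proof. exact: enum_val_inj. Qed.

Lemma orbit_rep_onto p : froot r p = p -> exists i, orbit_rep i = p.
Proof.
move=> pP; have pA : p \in froots r by exact/eqP.
by exists (enum_rank_in pA p); rewrite /orbit_rep enum_rankK_in.
Qed.

Lemma gen2_r p : gen (r p).1 * gen (r p).2 = gen p.1 * gen p.2.
Proof. by case: p => x y; rewrite -(struct_gen_rel K (surjective_pairing _)). Qed.

Lemma gen2_iter n p :
  gen (iter n r p).1 * gen (iter n r p).2 = gen p.1 * gen p.2.
Proof.
elim: n => [|n IHn]; first reflexivity.
exact (etrans (gen2_r (iter n r p)) IHn).
Qed.

Lemma has_dim_degree2 :
  injective r -> has_dim (homcomp K r 2) #|froots r|.
Proof.
move=> r_inj; have r_sym := fconnect_sym r_inj.
exists (fun i => gen (orbit_rep i).1 * gen (orbit_rep i).2); split.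
- move=> i; exists [:: (1, [tuple (orbit_rep i).1; (orbit_rep i).2])].
  by rewrite big_seq1 scale1r big_cons big_seq1.
- move=> c c0 i.
  (* The indicator of the [i]-th orbit extracts the coefficient [c i]. *)
  pose phi p := (froot r p == orbit_rep i)%:R : K.
  have phi_r p : phi (r p) = phi p.
    rewrite /phi; congr ((_ == _)%:R); apply/(fingraph.rootP r_sym).
    by rewrite r_sym fconnect1.
  pose term j : freeAlg :=
    c j *: (fgen K (orbit_rep j).1 * fgen K (orbit_rep j).2).
  have term_rel : \sum_j term j \in rel_ideal r.
    rewrite -[X in X \in _]subr0; apply/struct_prP.
    rewrite struct_pr0 -c0 [LHS]raddf_sum /=.
    by apply: eq_bigr => j _; rewrite linearZ rmorphM.
  have termE j : quad_form phi (term j) = c j * (j == i)%:R.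
    by rewrite quad_form_gen2 /phi froot_rep (inj_eq orbit_rep_inj).
  have := quad_form_rel phi_r term_rel.
  rewrite raddf_sum (bigD1 i) //= big1 ?addr0 => [|j ji].
    by rewrite termE eqxx mulr1.
  by rewrite termE (negPf ji) mulr0.
- move=> w [s ->].
  have gen_root p : exists i,
      gen p.1 * gen p.2 = gen (orbit_rep i).1 * gen (orbit_rep i).2.
    have [i iE] := orbit_rep_onto (root_root r_sym p); exists i; rewrite iE.
    have /iter_findex <- := connect_root (frel r) p.
    by rewrite gen2_iter.
  elim: s => [|[a t] s [c IHs]].
    by exists (fun=> 0); rewrite big_nil big1 // => i _; rewrite scale0r.
  have [i tE] := gen_root (tnth t ord0, tnth t ord_max).
  exists (fun j => a * (j == i)%:R + c j).
  rewrite big_cons IHs /=.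
  under [RHS]eq_bigr do rewrite scalerDl.
  rewrite big_split /=; congr (_ + _).
  by rewrite sum_scale_delta -tE prod_tuple2.
Qed.
End DegreeTwo.

(** * The bound *)

Theorem corollary3p4 (X : finType) (r : X * X -> X * X) (K : fieldType) :
  braided_set r -> non_degenerate r ->
  (#|X|%:R / 2 : rat) <= (subspace_dim (homcomp K r 2))%:R.
Proof.
move=> r_braided r_nondeg.
have r_inj : injective r by case: r_braided => -[_ /bij_inj].
rewrite (subspace_dimE (has_dim_degree2 K r_inj)).
rewrite ler_pdivrMr ?ltr0n // -natrM ler_nat mulnC.
exact: leq_card_froots.
Qed.
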